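(* Let $A=A_{p,t,\mathcal A}$ be the simple Weyl-type algebra generated over $\mathbb F$ by $x_i,\partial_i$ $(1\le i\le n)$ and the symbols $e^{\pm x_i^{p_i}e^{t_ix_i}}$, $e^{\alpha x_i}$, $x_i^{\alpha}$ $(\alpha\in\mathcal A)$. Then every nontrivial representation of $A$ on a vector space over $\mathbb F$ is faithful and infinite-dimensional.
   Context: $\mathbb F$ is a field of characteristic zero, $\mathcal A$ is a finitely generated additive subgroup of $\mathbb F$, $n\ge 1$, $p=(p_1,\dots,p_n)\in\mathbb N^n$ and $t_1,\dots,t_n\in\mathbb F$. The Weyl-type algebra $A_{p,t,\mathcal A}$ is the associative $\mathbb F$-algebra generated by $x_i,\partial_i$ $(i=1,\dots,n)$ together with the symbols $e^{\pm x_i^{p_i}e^{t_ix_i}}$, $e^{\alpha x_i}$, $x_i^{\alpha}$ $(\alpha\in\mathcal A)$. The symbols multiply by the usual rules of exponents ($e^{\alpha x_i}e^{\beta x_i}=e^{(\alpha+\beta)x_i}$, $x_i^\alpha x_i^\beta=x_i^{\alpha+\beta}$, $e^{x_i^{p_i}e^{t_ix_i}}e^{-x_i^{p_i}e^{t_ix_i}}=1$) and commute with each other and with the $x_i$. The remaining relations are $$[\partial_i,x_j]=\delta_{ij},\quad [x_i,x_j]=0=[\partial_i,\partial_j],\quad [\partial_i,e^{\alpha x_j}]=\alpha\delta_{ij}e^{\alpha x_j},\quad [\partial_i,x_j^\alpha]=\alpha\delta_{ij}x_j^{\alpha-1},$$ $$[\partial_i,e^{x_j^{p_j}e^{t_jx_j}}]=\delta_{ij}\bigl(p_jx_j^{p_j-1}e^{t_jx_j}+t_jx_j^{p_j}e^{t_jx_j}\bigr)e^{x_j^{p_j}e^{t_jx_j}}.$$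 A representation of $A$ on an $\mathbb F$-vector space $V$ is an algebra homomorphism $\rho:A\to\operatorname{End}_{\mathbb F}(V)$; it is nontrivial if $\rho(A)\neq 0$ and faithful if $\rho$ is injective.
   Formalization: Simplicity of A is taken as a hypothesis, since it fails for some parameters (e.g. p=1, t=0, 1 in 𝒜); where t_i or 1 is not in 𝒜, the exponents are enlarged so that e^{t_i x_i} and x_i^{α-1} exist; x_i^1 is identified with x_i. *)

(* Defs.v *)
From HB Require Import structures.
From mathcomp Require Import all_boot all_algebra ring.
From mathcomp Require Import boolp.
Set Implicit Arguments.
Unset Strict Implicit.
Unset Printing Implicit Defensive.
Import GRing.Theory.
Local Open Scope ring_scope.
Local Open Scope quotient_scope.

Definition fg_additive_subgroup (V : zmodType) (A : V -> Prop) : Prop :=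
  exists m (s : m.-tuple V), forall a, A a <-> inIntSpan s a.

Section Exponents.
Variables (F : fieldType) (n : nat) (t : 'I_n -> F) (A : F -> Prop).

(* The relations also mention e^{t_i x_i} and x_i^{a - 1}, hence presuppose
   symbols for these exponents.  The exponents of e^{a x_i} are therefore taken
   in A + Z t_i, and those of x_i^a in the least set that contains A, is closed
   under addition and contains a - 1 with each nonzero a.  Both are A itself
   when t_i and 1 belong to A. *)
Definition exp_exponent (i : 'I_n) (a : F) : Prop :=
  exists b (k : int), A b /\ a = b + t i *~ k.

Inductive pow_exponent : F -> Prop :=
| PowExpBase a : A a -> pow_exponent a
| PowExpAdd a b : pow_exponent a -> pow_exponent b -> pow_exponent (a + b)
| PowExpPred a : a != 0 -> pow_exponent a -> pow_exponent (a - 1).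

End Exponents.

Section Presentation.
Variables (F : fieldType) (n : nat) (p : 'I_n -> nat) (t : 'I_n -> F).
Variable A : F -> Prop.

(* In order: x_i, d_i, e^{x_i^{p_i} e^{t_i x_i}}, its inverse, e^{a x_i}, x_i^a. *)
Inductive weyl_gen : Type :=
| GenX of 'I_n
| GenD of 'I_n
| GenE of 'I_n
| GenEinv of 'I_n
| GenExp (i : 'I_n) (a : F) of exp_exponent t A i a
| GenPow (i : 'I_n) (a : F) of pow_exponent A a.

Inductive weyl_term : Type :=
| TGen of weyl_gen
| TCst of F
| TAdd of weyl_term & weyl_term
| TMul of weyl_term & weyl_term.

Local Notation "u ∔ v" := (TAdd u v) (at level 50, left associativity).
Local Notation "u ⊡ v" := (TMul u v) (at level 40, left associativity).
Local Notation X i := (TGen (GenX i)).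
Local Notation D i := (TGen (GenD i)).
Local Notation E i := (TGen (GenE i)).
Local Notation Einv i := (TGen (GenEinv i)).
Local Notation Exp i h := (TGen (@GenExp i _ h)).
Local Notation Pow i h := (TGen (@GenPow i _ h)).

Definition tcomm (u v : weyl_term) : weyl_term := u ⊡ v ∔ TCst (-1) ⊡ (v ⊡ u).

Definition tpow (u : weyl_term) (k : nat) : weyl_term := iter k (TMul u) (TCst 1).

Definition not_D (g : weyl_gen) : bool := if g is GenD _ then false else true.

Inductive weyl_rel : weyl_term -> weyl_term -> Prop :=
| RelComm g g' : not_D g -> not_D g' -> weyl_rel (TGen g ⊡ TGen g') (TGen g' ⊡ TGen g)
| RelDD i j : weyl_rel (D i ⊡ D j) (D j ⊡ D i)
| RelDX i j : weyl_rel (tcomm (D i) (X j)) (TCst (i == j)%:R)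
| RelEEinv i : weyl_rel (E i ⊡ Einv i) (TCst 1)
| RelExp0 i (h : exp_exponent t A i 0) : weyl_rel (Exp i h) (TCst 1)
| RelExpD i a b (ha : exp_exponent t A i a) (hb : exp_exponent t A i b)
    (hab : exp_exponent t A i (a + b)) :
    weyl_rel (Exp i ha ⊡ Exp i hb) (Exp i hab)
| RelPow0 i (h : pow_exponent A 0) : weyl_rel (Pow i h) (TCst 1)
| RelPow1 i (h : pow_exponent A 1) : weyl_rel (Pow i h) (X i)
| RelPowD i a b (ha : pow_exponent A a) (hb : pow_exponent A b)
    (hab : pow_exponent A (a + b)) :
    weyl_rel (Pow i ha ⊡ Pow i hb) (Pow i hab)
| RelDExp i j a (h : exp_exponent t A j a) :
    weyl_rel (tcomm (D i) (Exp j h)) (TCst (a *+ (i == j)) ⊡ Exp j h)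
| RelDPow i j a (h : pow_exponent A a) (h' : pow_exponent A (a - 1)) :
    weyl_rel (tcomm (D i) (Pow j h)) (TCst (a *+ (i == j)) ⊡ Pow j h')
| RelDE i j (h : exp_exponent t A j (t j)) :
    weyl_rel (tcomm (D i) (E j))
      (TCst (i == j)%:R ⊡
        (TCst (p j)%:R ⊡ tpow (X j) (p j).-1 ⊡ Exp j h
          ∔ TCst (t j) ⊡ tpow (X j) (p j) ⊡ Exp j h)
        ⊡ E j).

(* The least F-algebra congruence containing weyl_rel. *)
Inductive weyl_congr : weyl_term -> weyl_term -> Prop :=
| CongrRel u v : weyl_rel u v -> weyl_congr u v
| CongrRefl u : weyl_congr u u
| CongrSym u v : weyl_congr u v -> weyl_congr v u
| CongrTrans u v w : weyl_congr u v -> weyl_congr v w -> weyl_congr u w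
| CongrAdd u u' v v' : weyl_congr u u' -> weyl_congr v v' ->
    weyl_congr (u ∔ v) (u' ∔ v')
| CongrMul u u' v v' : weyl_congr u u' -> weyl_congr v v' ->
    weyl_congr (u ⊡ v) (u' ⊡ v')
| CongrAddA u v w : weyl_congr (u ∔ (v ∔ w)) (u ∔ v ∔ w)
| CongrAddC u v : weyl_congr (u ∔ v) (v ∔ u)
| CongrAdd0 u : weyl_congr (TCst 0 ∔ u) u
| CongrAddN u : weyl_congr (TCst (-1) ⊡ u ∔ u) (TCst 0)
| CongrMulA u v w : weyl_congr (u ⊡ (v ⊡ w)) (u ⊡ v ⊡ w)
| CongrMul1 u : weyl_congr (TCst 1 ⊡ u) u
| CongrMulDl u v w : weyl_congr ((u ∔ v) ⊡ w) (u ⊡ w ∔ v ⊡ w)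
| CongrMulDr u v w : weyl_congr (u ⊡ (v ∔ w)) (u ⊡ v ∔ u ⊡ w)
| CongrCstD c d : weyl_congr (TCst (c + d)) (TCst c ∔ TCst d)
| CongrCstM c d : weyl_congr (TCst (c * d)) (TCst c ⊡ TCst d)
| CongrCstC c u : weyl_congr (TCst c ⊡ u) (u ⊡ TCst c).

HB.instance Definition _ := gen_eqMixin weyl_term.
HB.instance Definition _ := gen_choiceMixin weyl_term.

Definition weyl_eqv (u v : weyl_term) : bool := `[< weyl_congr u v >].

Fact weyl_eqv_equiv : equiv_class_of weyl_eqv.
Proof.
split=> [u|u v|v u w].
- by apply/asboolP/CongrRefl.
- by apply/asboolP/asboolP; apply: CongrSym.
- by move=> /asboolP uv /asboolP vw; apply/asboolP; apply: CongrTrans uv vw.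
Qed.

Canonical weyl_equiv := EquivRelPack weyl_eqv_equiv.

Definition weyl_algebra : Type := {eq_quot weyl_equiv}.
HB.instance Definition _ := Choice.on weyl_algebra.
HB.instance Definition _ := EqQuotient.on weyl_algebra.

Definition weyl_pi (u : weyl_term) : weyl_algebra := \pi_({eq_quot weyl_equiv}) u.

Fact weyl_piP u v : weyl_pi u = weyl_pi v <-> weyl_congr u v.
Proof. by split=> [/eqquotP/asboolP|uv]; last by apply/eqquotP/asboolP. Qed.

Fact weyl_piW (P : weyl_algebra -> Prop) : (forall u, P (weyl_pi u)) -> forall x, P x.
Proof. by move=> Pu; apply: quotW. Qed.

Fact weyl_repr u : weyl_congr (repr (weyl_pi u)) u.
Proof. by apply/weyl_piP; rewrite /weyl_pi reprK. Qed.

Definition weyl_add (x y : weyl_algebra) := weyl_pi (repr x ∔ repr y).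
Definition weyl_mul (x y : weyl_algebra) := weyl_pi (repr x ⊡ repr y).
Definition weyl_opp (x : weyl_algebra) := weyl_pi (TCst (-1) ⊡ repr x).
Definition weyl_scale (c : F) (x : weyl_algebra) := weyl_pi (TCst c ⊡ repr x).

Fact weyl_addE u v : weyl_add (weyl_pi u) (weyl_pi v) = weyl_pi (u ∔ v).
Proof. by apply/weyl_piP; apply: CongrAdd; apply: weyl_repr. Qed.
Fact weyl_mulE u v : weyl_mul (weyl_pi u) (weyl_pi v) = weyl_pi (u ⊡ v).
Proof. by apply/weyl_piP; apply: CongrMul; apply: weyl_repr. Qed.
Fact weyl_oppE u : weyl_opp (weyl_pi u) = weyl_pi (TCst (-1) ⊡ u).
Proof.
by apply/weyl_piP; apply: CongrMul; [apply: CongrRefl | apply: weyl_repr].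
Qed.
Fact weyl_scaleE c u : weyl_scale c (weyl_pi u) = weyl_pi (TCst c ⊡ u).
Proof.
by apply/weyl_piP; apply: CongrMul; [apply: CongrRefl | apply: weyl_repr].
Qed.

Fact weyl_addA : associative weyl_add.
Proof.
elim/weyl_piW=> u; elim/weyl_piW=> v; elim/weyl_piW=> w.
by rewrite !weyl_addE; apply/weyl_piP/CongrAddA.
Qed.
Fact weyl_addC : commutative weyl_add.
Proof.
elim/weyl_piW=> u; elim/weyl_piW=> v.
by rewrite !weyl_addE; apply/weyl_piP/CongrAddC.
Qed.
Fact weyl_add0 : left_id (weyl_pi (TCst 0)) weyl_add.
Proof. by elim/weyl_piW=> u; rewrite weyl_addE; apply/weyl_piP/CongrAdd0. Qed.
Fact weyl_addN : left_inverse (weyl_pi (TCst 0)) weyl_opp weyl_add.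
Proof.
by elim/weyl_piW=> u; rewrite weyl_oppE weyl_addE; apply/weyl_piP/CongrAddN.
Qed.

HB.instance Definition _ :=
  GRing.isZmodule.Build weyl_algebra weyl_addA weyl_addC weyl_add0 weyl_addN.

Fact weyl_mulA : associative weyl_mul.
Proof.
elim/weyl_piW=> u; elim/weyl_piW=> v; elim/weyl_piW=> w.
by rewrite !weyl_mulE; apply/weyl_piP/CongrMulA.
Qed.
Fact weyl_mul1l : left_id (weyl_pi (TCst 1)) weyl_mul.
Proof. by elim/weyl_piW=> u; rewrite weyl_mulE; apply/weyl_piP/CongrMul1. Qed.
Fact weyl_mul1r : right_id (weyl_pi (TCst 1)) weyl_mul.
Proof.
elim/weyl_piW=> u; rewrite weyl_mulE; apply/weyl_piP.
by apply: CongrTrans (CongrMul1 u); apply/CongrSym/CongrCstC.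
Qed.
Fact weyl_mulDl : left_distributive weyl_mul weyl_add.
Proof.
elim/weyl_piW=> u; elim/weyl_piW=> v; elim/weyl_piW=> w.
by rewrite !(weyl_addE, weyl_mulE); apply/weyl_piP/CongrMulDl.
Qed.
Fact weyl_mulDr : right_distributive weyl_mul weyl_add.
Proof.
elim/weyl_piW=> u; elim/weyl_piW=> v; elim/weyl_piW=> w.
by rewrite !(weyl_addE, weyl_mulE); apply/weyl_piP/CongrMulDr.
Qed.

(* Nontriviality of the algebra, by its action on the space of F-valued
   functions on the group of exponents (a, b, k) of the monomials
   x_i^a e^{b x_i} (e^{x_i^{p_i} e^{t_i x_i}})^k: such a function is a formal
   sum of monomials. *)
Local Notation expo := (F * F * int)%type.
Local Notation G := {ffun 'I_n -> expo}.

Let dl (i : 'I_n) (v : expo) : G := [ffun j => if j == i then v else 0].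

Let dlD i v w : dl i (v + w) = dl i v + dl i w.
Proof. by apply/ffunP=> j; rewrite !ffunE; case: eqP; rewrite ?addr0. Qed.

Let op (i : 'I_n) (s : seq ((expo -> F) * expo)) (f : G -> F) : G -> F :=
  fun h => \sum_(r <- s) r.1 (h i) * f (h - dl i r.2).

Let opC i j s s' f : i != j -> op i s (op j s' f) = op j s' (op i s f).
Proof.
move=> nij; apply/funext=> h; rewrite /op.
under eq_bigr do rewrite mulr_sumr.
under [RHS]eq_bigr do rewrite mulr_sumr.
rewrite exchange_big; apply: eq_bigr => r _; apply: eq_bigr => r' _.
rewrite !ffunE (negPf nij) eq_sym (negPf nij) !subr0 mulrCA.
by congr (_ * (_ * f _)); rewrite addrAC.
Qed.

Let sh (v : expo) : seq ((expo -> F) * expo) := [:: (fun=> 1, v)].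

Let shE i v f h : op i (sh v) f h = f (h - dl i v).
Proof. by rewrite /op big_seq1 /= mul1r. Qed.

Let shM i v w f : op i (sh v) (op i (sh w) f) = op i (sh (v + w)) f.
Proof. by apply/funext=> h; rewrite !shE dlD opprD addrA. Qed.

Let sd (i : 'I_n) : seq ((expo -> F) * expo) :=
  [:: (fun v => v.1.1 + 1, (-1, 0, 0)); (fun v => v.1.2, 0);
      (fun v => (p i)%:R * v.2%:~R, ((p i).-1%:R, t i, 0));
      (fun v => t i * v.2%:~R, ((p i)%:R, t i, 0))].

Let sdsh i v f h : op i (sd i) (op i (sh v) f) h - op i (sh v) (op i (sd i) f) h =
  v.1.1 * f (h - dl i (v - (1, 0, 0))) + v.1.2 * f (h - dl i v)
  + v.2%:~R * ((p i)%:R * f (h - dl i (v + ((p i).-1%:R, t i, 0)))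
               + t i * f (h - dl i (v + ((p i)%:R, t i, 0)))).
Proof.
rewrite shE /op !big_cons !big_nil /= !mul1r !ffunE eqxx.
have e w : h - dl i w - dl i v = h - dl i (v + w).
  by rewrite [v + w]addrC dlD opprD addrA.
have e' w : h - dl i v - dl i w = h - dl i (v + w) by rewrite dlD opprD addrA.
rewrite !e !e' addr0.
have -> : v + (-1, 0, 0) = v - (1, 0, 0) by congr (_ + (_, _, _)); rewrite oppr0.
rewrite /= !rmorphB /= [v + 0]addr0.
ring.
Qed.

Let geval (g : weyl_gen) : (G -> F) -> (G -> F) :=
  match g with
  | GenX i => op i (sh (1, 0, 0))
  | GenD i => op i (sd i)
  | GenE i => op i (sh (0, 0, 1))
  | GenEinv i => op i (sh (0, 0, -1))
  | GenExp i a _ => op i (sh (0, a, 0))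
  | GenPow i a _ => op i (sh (a, 0, 0))
  end.

Let eval : weyl_term -> (G -> F) -> (G -> F) := fix eval u f :=
  match u with
  | TGen g => geval g f
  | TCst c => fun h => c * f h
  | u1 ∔ u2 => fun h => eval u1 f h + eval u2 f h
  | u1 ⊡ u2 => eval u1 (eval u2 f)
  end.

Let opL i s c (f f' : G -> F) :
  op i s (fun h => c * f h + f' h) = fun h => c * op i s f h + op i s f' h.
Proof.
apply/funext=> h; rewrite /op mulr_sumr -big_split /=.
by apply: eq_bigr => r _; rewrite mulrDr mulrCA.
Qed.

Let evalL u c (f f' : G -> F) :
  eval u (fun h => c * f h + f' h) = fun h => c * eval u f h + eval u f' h.
Proof.
elim: u f f' => [g|d|u IHu v IHv|u IHu v IHv] f f' /=.
- by case: g => * /=; rewrite opL.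
- by apply/funext=> h; ring.
- by rewrite IHu IHv; apply/funext=> h; ring.
- by rewrite IHv IHu.
Qed.

Let evalX i k f : eval (tpow (X i) k) f = op i (sh (k%:R, 0, 0)) f.
Proof.
elim: k => [|k IHk] /=.
  apply/funext=> h; rewrite mul1r shE; congr f.
  by rewrite [dl _ _](_ : _ = 0) ?subr0 //; apply/ffunP=> j; rewrite !ffunE if_same.
by rewrite -/(tpow _ _) IHk shM; congr (op _ (sh (_, _, _)) _); rewrite ?addr0 ?nat1r.
Qed.

Let sh0 i v f : v = 0 -> op i (sh v) f = f.
Proof.
move=> ->; apply/funext=> h; rewrite shE; congr f.
by rewrite [dl _ _](_ : _ = 0) ?subr0 //; apply/ffunP=> j; rewrite !ffunE if_same.
Qed.

Let gshift g : not_D g -> exists i v, geval g = op i (sh v).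
Proof. by case: g => // i *; exists i; eexists. Qed.

Let eval_comm i j s f h : i != j ->
  op i (sd i) (op j s f) h + -1 * op j s (op i (sd i) f) h = 0.
Proof. by move=> nij; rewrite opC // mulN1r subrr. Qed.

Let eval_rel u v : weyl_rel u v -> eval u =1 eval v.
Proof.
case=> {u v}.
- move=> g g' /gshift[i [v ev]] /gshift[j [w ew]] f /=; rewrite ev ew.
  by have [<-|nij] := eqVneq i j; [rewrite !shM addrC | rewrite opC].
- move=> i j f /=; by have [<-|nij] := eqVneq i j; last by rewrite opC.
- move=> i j f; apply/funext=> h /=; have [<-|nij] := eqVneq i j.
    rewrite mulN1r sdsh /= subrr !mul0r !addr0 mul1r mul1r; congr f.
    by rewrite [dl _ _](_ : _ = 0) ?subr0 //; apply/ffunP=> l; rewrite !ffunE if_same.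
  by rewrite eval_comm // mul0r.
- move=> i f /=; rewrite shM sh0; last by congr (_, _, _); rewrite ?addr0 ?subrr.
  by apply/funext=> h; rewrite mul1r.
- by move=> i hh f /=; rewrite sh0 //; apply/funext=> h; rewrite mul1r.
- by move=> i a b ha hb hab f /=; rewrite shM; congr (op _ (sh (_, _, _)) _); rewrite addr0.
- by move=> i hh f /=; rewrite sh0 //; apply/funext=> h; rewrite mul1r.
- by [].
- by move=> i a b ha hb hab f /=; rewrite shM; congr (op _ (sh (_, _, _)) _); rewrite addr0.
- move=> i j a hh f; apply/funext=> h /=; have [<-|nij] := eqVneq i j.
    by rewrite mulN1r sdsh /= !mul0r add0r addr0 mulr1n shE.
  by rewrite eval_comm // mulr0n mul0r.
- move=> i j a hh hh' f; apply/funext=> h /=; have [<-|nij] := eqVneq i j.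
    rewrite mulN1r sdsh /= !mul0r !addr0 mulr1n shE.
    by congr (_ * f (h - dl _ (_, _, _))); rewrite ?subr0.
  by rewrite eval_comm // mulr0n mul0r.
- move=> i j hh f; apply/funext=> h /=; have [<-|nij] := eqVneq i j.
    rewrite !evalX mulN1r sdsh /= !shM !shE !mul0r !add0r !mul1r.
    congr (_ * f (h - dl _ _) + _ * f (h - dl _ _)); congr (_, _, _) => /=;
      by rewrite ?addr0 ?add0r.
  by rewrite eval_comm // mul0r.
Qed.

Let eval_congr u v : weyl_congr u v -> eval u =1 eval v.
Proof.
elim=> {u v} /=.
- exact: eval_rel.
- by [].
- by move=> u v _ e f; rewrite e.
- by move=> u v w _ e _ e' f; rewrite e e'.
- by move=> u u' v v' _ e _ e' f; rewrite e e'.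
- by move=> u u' v v' _ e _ e' f; rewrite e' e.
- by move=> u v w f; apply/funext=> h; rewrite addrA.
- by move=> u v f; apply/funext=> h; rewrite addrC.
- by move=> u f; apply/funext=> h; rewrite mul0r add0r.
- by move=> u f; apply/funext=> h; rewrite mulN1r addNr mul0r.
- by [].
- by move=> u f; apply/funext=> h; rewrite mul1r.
- by [].
- move=> u v w f; rewrite -[eval w f](_ : (fun h => 1 * eval w f h) = _); last first.
    by apply/funext=> h; rewrite mul1r.
  have -> : (fun h => eval v f h + 1 * eval w f h) = (fun h => 1 * eval w f h + eval v f h).
    by apply/funext=> h; rewrite addrC.
  rewrite evalL; apply/funext=> h.
  have -> : (fun h => 1 * eval w f h) = eval w f by apply/funext=> k; rewrite mul1r.
  by rewrite mul1r addrC.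
- by move=> c d f; apply/funext=> h; rewrite mulrDl.
- by move=> c d f; apply/funext=> h; rewrite mulrA.
- move=> c u f.
  have -> : (fun h => c * f h) = (fun h => c * f h + 0 * f h).
    by apply/funext=> h; rewrite mul0r addr0.
  rewrite (evalL u c f (fun h => 0 * f h)); apply/funext=> h.
  have -> : (fun h => 0 * f h) = (fun h => (-1) * f h + f h).
    by apply/funext=> k; rewrite mulN1r addNr mul0r.
  by rewrite evalL mulN1r addNr addr0.
Qed.

Fact weyl_1neq0 : weyl_pi (TCst 1) != 0.
Proof.
apply/eqP=> /weyl_piP/eval_congr/(_ (fun=> 1))/(congr1 (fun f => f 0))/eqP.
by rewrite /= mul1r mul0r oner_eq0.
Qed.

HB.instance Definition _ := GRing.Zmodule_isNzRing.Build weyl_algebra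
  weyl_mulA weyl_mul1l weyl_mul1r weyl_mulDl weyl_mulDr weyl_1neq0.

Fact weyl_scaleA c d x : weyl_scale c (weyl_scale d x) = weyl_scale (c * d) x.
Proof.
elim/weyl_piW: x => u; rewrite !weyl_scaleE; apply/weyl_piP.
apply: CongrTrans (CongrMulA _ _ _) _; apply: CongrMul (CongrRefl _).
exact/CongrSym/CongrCstM.
Qed.
Fact weyl_scale1 : left_id 1 weyl_scale.
Proof. by elim/weyl_piW=> u; rewrite weyl_scaleE; apply/weyl_piP/CongrMul1. Qed.
Fact weyl_scaleDr : right_distributive weyl_scale +%R.
Proof.
move=> c; elim/weyl_piW=> u; elim/weyl_piW=> v.
rewrite -![_ + _]/(weyl_add _ _) !(weyl_scaleE, weyl_addE).
exact/weyl_piP/CongrMulDr.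
Qed.
Fact weyl_scaleDl x : {morph weyl_scale^~ x : c d / c + d}.
Proof.
move=> c d /=; elim/weyl_piW: x => u.
rewrite -[RHS]/(weyl_add _ _) !(weyl_scaleE, weyl_addE); apply/weyl_piP.
apply: CongrTrans (CongrMulDl _ _ _); apply: CongrMul (CongrRefl _).
exact: CongrCstD.
Qed.

HB.instance Definition _ := GRing.Zmodule_isLmodule.Build F weyl_algebra
  weyl_scaleA weyl_scale1 weyl_scaleDr weyl_scaleDl.

Fact weyl_scaleAl (c : F) (x y : weyl_algebra) : c *: (x * y) = (c *: x) * y.
Proof.
elim/weyl_piW: x => u; elim/weyl_piW: y => v.
rewrite -![_ * _]/(weyl_mul _ _) -![_ *: _]/(weyl_scale _ _).
by rewrite !(weyl_scaleE, weyl_mulE); apply/weyl_piP/CongrMulA.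
Qed.

HB.instance Definition _ :=
  GRing.Lmodule_isLalgebra.Build F weyl_algebra weyl_scaleAl.

Fact weyl_scaleAr (c : F) (x y : weyl_algebra) : c *: (x * y) = x * (c *: y).
Proof.
elim/weyl_piW: x => u; elim/weyl_piW: y => v.
rewrite -![_ * _]/(weyl_mul _ _) -![_ *: _]/(weyl_scale _ _).
rewrite !(weyl_scaleE, weyl_mulE); apply/weyl_piP.
apply: CongrTrans (CongrMulA _ _ _) _; apply: CongrTrans (CongrSym (CongrMulA _ _ _)).
by apply: CongrMul (CongrRefl _); apply: CongrCstC.
Qed.

HB.instance Definition _ :=
  GRing.Lalgebra_isAlgebra.Build F weyl_algebra weyl_scaleAr.

End Presentation.

Definition two_sided_ideal (R : nzRingType) (I : R -> Prop) : Prop :=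
  [/\ I 0, forall a b, I a -> I b -> I (a - b)
    & forall a b, I b -> I (a * b) /\ I (b * a)].

(* For weyl_algebra this is a genuine restriction on p, t and A: if p_i = 1,
   t_i = 0 and 1 \in A, the symbols e^{x_i^1 e^{0 x_i}} and e^{1 x_i} differ by
   a central unit that is not a scalar. *)
Definition simple_algebra (R : nzRingType) : Prop :=
  forall I : R -> Prop, two_sided_ideal I ->
    (forall a, I a -> a = 0) \/ (forall a, I a).

Section Representations.
Variables (F : fieldType) (R : algType F) (V : lmodType F).

(* rho 1 need not be the identity, so that the zero map is a representation of
   any V; unital representations on V <> 0 are a special case. *)
Definition is_representation (rho : R -> {linear V -> V}) : Prop :=
  [/\ forall a b v, rho (a + b) v = rho a v + rho b v,
      forall c a v, rho (c *: a) v = c *: rho a v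
    & forall a b v, rho (a * b) v = rho a (rho b v)].

Definition nontrivial_rep (rho : R -> {linear V -> V}) : Prop :=
  exists a v, rho a v != 0.

Definition faithful_rep (rho : R -> {linear V -> V}) : Prop :=
  forall a b, rho a =1 rho b -> a = b.

End Representations.

Definition finite_dimensional (F : fieldType) (V : lmodType F) : Prop :=
  exists m (s : m.-tuple V), forall v, exists c : 'I_m -> F,
    v = \sum_(i < m) c i *: tnth s i.

(* Main.v *)
Require Import Defs.
From mathcomp Require Import all_boot all_algebra.
From mathcomp Require Import boolp.
Set Implicit Arguments.
Unset Strict Implicit.
Unset Printing Implicit Defensive.
Import GRing.Theory.
Local Open Scope ring_scope.

(** The kernel of a representation is a two-sided ideal, so simplicity gives
faithfulness.  If V were spanned by m vectors, the matrix M of rho x_i on them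
would satisfy its characteristic polynomial chi, so that chi(x_i) x_i = 0 by
faithfulness.  Bracketing with d_i differentiates polynomials in x_i, so in
characteristic zero no nonzero polynomial annihilates x_i. *)

Section PolynomialsInCanonicalVariable.
Variables (F : fieldType) (R : algType F) (d x : R).
Hypotheses (charF0 : [pchar F] =i pred0) (dx : d * x - x * d = 1).

(** The bracket with [d] is a derivation that kills scalars and sends [x] to 1, and these properties
    determine the formal derivative. *)
Lemma commutator_horner_alg (q : {poly F}) :
  d * horner_alg x q - horner_alg x q * d = horner_alg x q^`().
Proof.
elim/poly_ind: q => [|q c IHq]; first by rewrite deriv0 !rmorph0 mulr0 mul0r subrr.
rewrite derivD derivM derivX derivC addr0 mulr1 !rmorphD !rmorphM /=.
rewrite !horner_algX !horner_algC -IHq mulrDr mulrDl mulr_algl mulr_algr.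
(* The scalar [c] commutes with [d] and cancels. Expanding the last q(x) as q(x)(dx - xd) makes the
   right side telescope. *)
rewrite opprD addrACA subrr addr0 -[X in _ = _ + X]mulr1 -dx mulrBl mulrBr.
by rewrite !mulrA addrA subrK.
Qed.

(** Descent on the size: by the bracket the derivative of [q] also annihilates [x], so it is 0. Its
    coefficients are (j+1) times those of [q], so [q] is constant, and a nonzero constant stays
    nonzero in [R]. *)
Lemma horner_alg_eq0 (q : {poly F}) : horner_alg x q = 0 -> q = 0.
Proof.
have [k] := ubnP (size q); elim: k q => // k IHk q lt_q_k qx0.
apply/eqP; apply: contraT => q_neq0.
have dq0 : q^`() = 0.
  apply: IHk; last by rewrite -commutator_horner_alg qx0 mulr0 mul0r subrr.
  exact: leq_trans (lt_size_deriv q_neq0) lt_q_k.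
have qC : q = (q`_0)%:P.
  apply/polyP=> -[|j]; rewrite coefC //=.
  have /eqP := congr1 (fun r : {poly F} => r`_j) dq0.
  by rewrite coef_deriv coef0 -mulr_natr mulf_eq0 (iffLR (pcharf0P F) charF0) orbF => /eqP.
move: qx0; rewrite qC horner_algC => /eqP.
by rewrite scaler_eq0 oner_eq0 orbF -polyC_eq0 -qC (negPf q_neq0).
Qed.

End PolynomialsInCanonicalVariable.

Section RepresentationTheory.
Variables (F : fieldType) (R : algType F) (V : lmodType F).
Variable rho : R -> {linear V -> V}.
Hypothesis rho_rep : is_representation rho.

Lemma rep0 v : rho 0 v = 0.
Proof. by case: rho_rep => _ /(_ 0 0 v); rewrite !scale0r. Qed.

Lemma repB a b v : rho (a - b) v = rho a v - rho b v.
Proof. by case: rho_rep => rhoD rhoZ _; rewrite rhoD -(scaleN1r b) rhoZ scaleN1r. Qed.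

Lemma simple_faithful :
  simple_algebra R -> nontrivial_rep rho -> faithful_rep rho.
Proof.
move=> simpleR [a0 [v0 nz]] a b eq_ab; apply/subr0_eq.
have [_ _ rhoM] := rho_rep.
case: (simpleR (fun c => forall v, rho c v = 0)) => [|ker0|kerT].
- split=> [v|c c' c0 c'0 v|c c' c'0]; first exact: rep0.
    by rewrite repB c0 c'0 subrr.
  by split=> v; rewrite rhoM ?c'0 // linear0.
- by apply: ker0 => v; rewrite repB eq_ab subrr.
- by rewrite kerT eqxx in nz.
Qed.

(* The factor 'X is there because rho 1 need not be the identity of V. *)
Lemma rep_horner_alg (x : R) m (M : 'M[F]_m.+1) (s : m.+1.-tuple V) :
    (forall i, rho x (tnth s i) = \sum_j M i j *: tnth s j) ->
  forall q i, rho (horner_alg x (q * 'X)) (tnth s i) =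
    \sum_j (horner_mx M (q * 'X)) i j *: tnth s j.
Proof.
move=> sM; have [rhoD rhoZ rhoM] := rho_rep.
elim/poly_ind=> [|q c IHq] i.
  by rewrite mul0r !rmorph0 rep0 big1 // => j _; rewrite mxE scale0r.
rewrite mulrDl; set r := q * 'X in IHq *.
(* Row i of [M] expands the image of the i-th vector, so [rho x], which acts first, gives the left
   matrix factor but the right factor in [R]. *)
have -> : horner_mx M (r * 'X + c%:P * 'X) = M *m horner_mx M r + c *: M.
  rewrite rmorphD /= [r * _]mulrC mul_polyC linearZ rmorphM /= horner_mx_X.
  by rewrite mulmxE.
have -> : horner_alg x (r * 'X + c%:P * 'X) = horner_alg x r * x + c *: x.
  by rewrite rmorphD !rmorphM /= horner_algX horner_algC mulr_algl.
rewrite rhoD rhoM rhoZ !sM.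
rewrite linear_sum scaler_sumr.
under eq_bigr do rewrite linearZ /= IHq scaler_sumr.
rewrite exchange_big -big_split; apply: eq_bigr => j _ /=.
rewrite !mxE scalerDl scaler_suml scalerA; congr (_ + _).
by apply: eq_bigr => l _; rewrite scalerA.
Qed.

Lemma faithful_fd_root (x : R) : faithful_rep rho -> nontrivial_rep rho ->
  finite_dimensional V -> exists2 q : {poly F}, q != 0 & horner_alg x q = 0.
Proof.
move=> faith [a0 [v0 nz]] [[|m] [s gen_s]].
  (* An empty spanning family would force [rho a0 v0 = 0]. *)
  by have [c] := gen_s (rho a0 v0); rewrite big_ord0 => e; rewrite e eqxx in nz.
(* [s] spans but may be dependent, so the coefficients are chosen, not determined. *)
have [c cE] := choice (fun i => gen_s (rho x (tnth s i))).
pose M : 'M[F]_m.+1 := \matrix_(i, j) c i j.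
have sM i : rho x (tnth s i) = \sum_j M i j *: tnth s j.
  by rewrite cE; apply: eq_bigr => j _; rewrite mxE.
(* The factor ['X] gives the shape that [rep_horner_alg] evaluates; Cayley-Hamilton kills the other
   factor. *)
exists (char_poly M * 'X).
  by rewrite mulf_neq0 ?polyX_eq0 // monic_neq0 ?char_poly_monic.
apply: faith => v; have [e ->] := gen_s v.
rewrite rep0 linear_sum big1 // => i _; rewrite linearZ /= (rep_horner_alg sM).
rewrite rmorphM /= Cayley_Hamilton mul0r big1 ?scaler0 // => j _.
by rewrite mxE scale0r.
Qed.

End RepresentationTheory.

(** Computed on representatives, this is the relation [RelDX] with equal indices. *)
Lemma weyl_commDX (F : fieldType) n (p : 'I_n -> nat) (t : 'I_n -> F)
    (A : F -> Prop) (i : 'I_n) :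
  let gen g := weyl_pi p (TGen (g : weyl_gen t A)) in
  gen (GenD t A i) * gen (GenX t A i) - gen (GenX t A i) * gen (GenD t A i) = 1.
Proof.
rewrite /= -[_ + _]/(weyl_add _ (weyl_opp (weyl_mul _ _))).
rewrite -[_ * _]/(weyl_mul _ _) !(weyl_mulE, weyl_oppE, weyl_addE).
by apply/weyl_piP/CongrRel; have := RelDX p t A i i; rewrite eqxx.
Qed.

Theorem theorem3p2 (F : fieldType) (charF0 : [pchar F] =i pred0)
    (A : F -> Prop) (fgA : fg_additive_subgroup A)
    (n : nat) (n_ge1 : (1 <= n)%N) (p : 'I_n -> nat) (t : 'I_n -> F)
    (simpleA : simple_algebra (weyl_algebra p t A))
    (V : lmodType F) (rho : weyl_algebra p t A -> {linear V -> V})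
    (rho_rep : is_representation rho) (rho_nontrivial : nontrivial_rep rho) :
  faithful_rep rho /\ ~ finite_dimensional V.
Proof.
have faith := simple_faithful rho_rep simpleA rho_nontrivial.
(* The bound on [n] supplies a pair x_i, d_i, at index 0. *)
split=> // fdV; pose i := Ordinal n_ge1.
have [q q_neq0 qx0] := faithful_fd_root rho_rep
  (weyl_pi p (TGen (GenX t A i))) faith rho_nontrivial fdV.
by rewrite (horner_alg_eq0 charF0 (weyl_commDX p t A i) qx0) eqxx in q_neq0.
Qed.
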